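(* Suppose that $\mu_{\widehat{F}}+\mu_R>0$ and that every $H_m$ is $L_m$-smooth, for some $L_m>0$. Let $x^\star$ be the unique minimizer of $\Psi$. Suppose that $\gamma_k\equiv\gamma\in(0,2/L_{\widehat{F}})$ and $\eta\geq\|\widehat{K}\|^2$, where $\|\widehat{K}\|^2=\max_{m=1,\ldots,M}\|K_m\|^2$ or, in the case $F_m\equiv0$ for all $m$, $\|\widehat{K}\|^2=\big\|\sum_{m=1}^M\omega_mK_m^*K_m\big\|$. Then the Distributed PDDY Algorithm converges linearly: there exist $\rho\in(0,1]$ and $\hat{c}_0>0$ such that, for every $k\in\mathbb{N}$, $$\|x_R^{k+1}-x^\star\|^2\leq(1-\rho)^k\hat{c}_0.$$
   Context: Let $M\geq1$. $\mathcal{X}$ and $\mathcal{U}_1,\ldots,\mathcal{U}_M$ are finite-dimensional real Hilbert spaces; $K_m:\mathcal{X}\to\mathcal{U}_m$ are linear operators with adjoints $K_m^*$; $R:\mathcal{X}\to\mathbb{R}\cup\{+\infty\}$ and $H_m:\mathcal{U}_m\to\mathbb{R}\cup\{+\infty\}$ are proper, closed, convex; $F_m:\mathcal{X}\to\mathbb{R}$ are convex and $L_{F_m}$-smooth, $L_{F_m}>0$ ($L$-smooth: differentiable with $L$-Lipschitz gradient). For a function $G$, $\mu_G\geq0$ is some constant such that $G-\frac{\mu_G}{2}\|\cdot\|^2$ is convex. Set $$\Psi(x)=\frac1M\sum_{m=1}^M\big(F_m(x)+H_m(K_mx)\big)+R(x).$$ $(\omega_m)_{m=1}^M$ are positive weights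 with $\sum_m\omega_m=1$. $G^*$ denotes the convex conjugate of $G$ and $\mathrm{prox}_G(z)=\arg\min_{z'}\{G(z')+\frac12\|z-z'\|^2\}$. Constants: $L_{\widehat{F}}=\max_{m}\frac{L_{F_m}}{M\omega_m}$ and $\mu_{\widehat{F}}=\min_m\frac{\mu_{F_m}}{M\omega_m}$. Standing assumption: there exists $x^\star\in\mathcal{X}$ with $0\in\frac1M\sum_{m=1}^M\big(\nabla F_m(x^\star)+K_m^*\partial H_m(K_mx^\star)\big)+\partial R(x^\star)$. Distributed PDDY Algorithm: given positive stepsizes $(\gamma_k)_{k\in\mathbb{N}}$, $\eta>0$, $x_R^0\in\mathcal{X}$, $u_m^0\in\mathcal{U}_m$, set $p_m^0=K_m^*u_m^0$, $m=1,\ldots,M$. For $k=0,1,\ldots$ iterate: for $m=1,\ldots,M$, $$u_m^{k+1}=\mathrm{prox}_{M\omega_mH_m^*/(\gamma_k\eta)}\Big(u_m^k+\tfrac{M\omega_m}{\gamma_k\eta}K_mx_R^k\Big),\quad p_m^{k+1}=K_m^*u_m^{k+1},$$ $$x_m^{k+1}=x_R^k-\tfrac{\gamma_k}{M\omega_m}(p_m^{k+1}-p_m^k),\quad a_m^k=M\omega_mx_m^{k+1}-\gamma_{k+1}\nabla F_m(x_m^{k+1})-\gamma_{k+1}p_m^{k+1},$$ and then $x_R^{k+1}=\mathrm{prox}_{\gamma_{k+1}R}\big(\frac1M\sum_{m=1}^Ma_m^k\big)$. *)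

(* Defs.v *)
From HB Require Import structures.
From mathcomp Require Import all_boot all_order all_algebra.
From mathcomp Require Import all_classical all_reals all_analysis.

Set Implicit Arguments.
Unset Strict Implicit.
Unset Printing Implicit Defensive.

Import Order.TTheory GRing.Theory Num.Theory.
Import numFieldNormedType.Exports.

Local Open Scope classical_set_scope.
Local Open Scope ring_scope.

HB.mixin Record NormedModule_isHilbert (R : realType) V
    of NormedModule R V := {
  inner : {dot V for idfun} ;
  inner_normE : forall x : V, inner x x = `|x| ^+ 2 }.

(* Finite dimension is the Vector structure.  It implies completeness, which
   is nevertheless kept as part of the notion of a Hilbert space. *)
#[short(type="finHilbertType")]
HB.structure Definition FinHilbert (R : realType) :=
  {V of CompleteNormedModule R V & Vector R V & NormedModule_isHilbert R V}.

Section Operators.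
Context {R : realType} {X Y : finHilbertType R}.

(* xget 0 picks the unique vector with the stated property; it exists by the
   Riesz representation theorem when K is linear. *)
Definition adjoint (K : X -> Y) (y : Y) : X :=
  xget 0 [set x | forall x', inner (K x') y = inner x' x].

Definition opnorm (K : X -> Y) : R :=
  sup [set `|K x| | x in [set x | `|x| <= 1]].

End Operators.

Section ConvexAnalysis.
Context {R : realType} {X : finHilbertType R}.

(* Functions X -> R u {+oo} are maps to \bar R that avoid -oo. *)
Definition proper_fun (f : X -> \bar R) : Prop :=
  (forall x, f x != -oo%E) /\ exists x, f x != +oo%E.

Definition epigraph (f : X -> \bar R) : set (X * R) :=
  [set z | (f z.1 <= z.2%:E)%E].

Definition closed_fun (f : X -> \bar R) : Prop := closed (epigraph f).

(* With 0 * +oo = 0, the cases t = 0 and t = 1 are trivially true. *)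
Definition convex_fun (f : X -> \bar R) : Prop :=
  forall (x y : X) (t : R), 0 <= t <= 1 ->
    (f (t *: x + (1 - t) *: y)%R <= t%:E * f x + (1 - t)%:E * f y)%E.

Definition strongly_convex_fun (mu : R) (f : X -> \bar R) : Prop :=
  convex_fun (fun x => f x - (mu / 2 * `|x| ^+ 2)%:E)%E.

Definition subdiff (f : X -> \bar R) (x : X) : set X :=
  [set v | forall y, (f x + (inner v (y - x)%R)%:E <= f y)%E].

Definition conjugate (f : X -> \bar R) (v : X) : \bar R :=
  ereal_sup [set ((inner x v)%:E - f x)%E | x in setT].

Definition argmin (f : X -> \bar R) : set X :=
  [set x | forall y, (f x <= f y)%E].

(* For f proper, closed and convex the argmin is a singleton. *)
Definition prox (f : X -> \bar R) (z : X) : X :=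
  xget 0 (argmin (fun z' => f z' + (2^-1 * `|z - z'| ^+ 2)%:E)%E).

(* The Riesz representative of the Frechet derivative. *)
Definition grad (f : X -> R) (x : X) : X :=
  xget 0 [set g | forall h, 'd f x h = inner g h].

Definition smooth_fun (L : R) (f : X -> R) : Prop :=
  (forall x, differentiable f x) /\ L.-lipschitz (grad f).

End ConvexAnalysis.

(* For M > 0, starting the fold from one of the values makes these the
   maximum and the minimum of the family. *)
Definition fam_max (R : realType) (M : nat) (M_gt0 : (0 < M)%N)
  (f : 'I_M -> R) : R := \big[Num.max/f (Ordinal M_gt0)]_(m < M) f m.

Definition fam_min (R : realType) (M : nat) (M_gt0 : (0 < M)%N)
  (f : 'I_M -> R) : R := \big[Num.min/f (Ordinal M_gt0)]_(m < M) f m.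

(* The objective is (1/M) sum_m (F_m + H_m o K_m) + G; the letter G stands for
   the nonsmooth term usually written R, which here is the field of reals. *)
Section DistributedPDDY.
Context {R : realType} {M : nat} {X : finHilbertType R}
  {U : 'I_M -> finHilbertType R}.
Variables (K : forall m, {linear X -> U m}).
Variables (F : 'I_M -> X -> R) (H : forall m, U m -> \bar R) (G : X -> \bar R).
Variable omega : 'I_M -> R.

Definition objective (x : X) : \bar R :=
  ((M%:R^-1)%:E * (\sum_(m < M) ((F m x)%:E + H (K m x))) + G x)%E.

(* 0 lies in M^-1 * sum_m (grad F_m x + K_m^* dH_m(K_m x)) + dG x. *)
Definition optimality_inclusion (x : X) : Prop :=
  exists (v : forall m, U m) (r : X),
    [/\ forall m, subdiff (H (m:=m)) (K m x) (v m),
        subdiff G x r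
      & 0 = M%:R^-1 *: (\sum_(m < M) (grad (F m) x + adjoint (K m) (v m))) + r].

(* The first iterate x 0 m is not used by the algorithm. *)
Record pddy_run (gamma : nat -> R) (eta : R) (xR : nat -> X)
    (u : nat -> forall m, U m) (p x a : nat -> 'I_M -> X) : Prop := {
  pddy_p0 : forall m, p 0%N m = adjoint (K m) (u 0%N m) ;
  pddy_u : forall k m, u k.+1 m =
    prox (fun v => ((M%:R * omega m / (gamma k * eta))%:E
                    * conjugate (H (m:=m)) v)%E)
      (u k m + (M%:R * omega m / (gamma k * eta)) *: K m (xR k)) ;
  pddy_p : forall k m, p k.+1 m = adjoint (K m) (u k.+1 m) ;
  pddy_x : forall k m, x k.+1 m =
    xR k - (gamma k / (M%:R * omega m)) *: (p k.+1 m - p k m) ;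
  pddy_a : forall k m, a k m =
    (M%:R * omega m) *: x k.+1 m - gamma k.+1 *: grad (F m) (x k.+1 m)
    - gamma k.+1 *: p k.+1 m ;
  pddy_xR : forall k, xR k.+1 =
    prox (fun z => ((gamma k.+1)%:E * G z)%E)
      (M%:R^-1 *: \sum_(m < M) a k m) }.

End DistributedPDDY.

(* Main.v *)
Require Import Defs.
From HB Require Import structures.
From mathcomp Require Import all_boot all_order all_algebra.
From mathcomp Require Import all_classical all_reals all_analysis.
From mathcomp Require Import ring lra.
Import Order.TTheory GRing.Theory Num.Theory.
Import numFieldNormedType.Exports.
Local Open Scope classical_set_scope.
Local Open Scope ring_scope.

(** The method is a preconditioned Davis-Yin splitting, and the theorem follows
    from a Lyapunov function with a strict decrease in all its arguments.

    Let [x*] solve the optimality inclusion with dual vectors [v_m], and put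
    [e_k = xR^k - x*], [w_k = u^k - v].  The function is [V_k = lyapunov e_k
    w_k], where
    [[
      lyapunov e w = |e|^2 + 2 gamma <e, P w> + gamma^2 eta Q w,
      P w = (1/M) sum_m K_m^* w_m,   Q w = sum_m |w_m|^2 / (M^2 omega_m).
    ]]
    [lyapunov_descent] is an exact energy balance: [V_k - V_(k+1)] is the sum of
    - the form evaluated at the differences of consecutive iterates,
    - the inner product of the variations of the gradients with [e_(k+1)],
    - two monotonicity terms, one from each proximal step.

    The form is nonnegative by Young's inequality under either lower bound on
    [eta].  If [eta >= |K_m|^2] for every [m], it even dominates the weighted
    sum of the [|x_m^(k+1) - xR^(k+1)|^2] ([lyapunov_ge]), which absorbs the
    gradient term: by cocoercivity a gradient step of size less than [2 / L] is
    nonexpansive, and it contracts under strong convexity ([gradient_step]).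
    Under the other bound the functions [F_m] vanish and nothing has to be
    absorbed.

    The decrease is at least a multiple of [|e_(k+1)|^2], by strong convexity of
    [G] or of the [F_m] ([lyapunov_coercive]).  It is also at least a multiple of
    [sum_m |w_(k+1),m|^2]: since [H_m] is smooth, Moreau's decomposition writes
    the dual step as [u_m^(k+1) = grad H_m (s_m)] ([prox_conjugate_grad]), and
    this gradient is cocoercive (Baillon-Haddad, [grad_cocoercive]).  Together
    they bound [V_(k+1)], so that [V_(k+1) <= C (V_k - V_(k+1))]: [V] decays
    geometrically, and so does [|e_(k+1)|^2], bounded by the decrease of [V].

    Two existence results give a meaning to the objects of the algorithm: Riesz
    representation for gradients and adjoints ([riesz]), and the resolvent
    equation for the proximal points ([resolvent_exists]). *)

(** * Inner products, Riesz representation and operator norms *)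

Section InnerProduct.
Context {R : realType} {X : finHilbertType R}.
Implicit Types x y z : X.

Lemma innerC x y : inner x y = inner y x.
Proof. by rewrite (hermC inner) expr0 mul1r. Qed.

Lemma innerDl x y z : inner (x + y) z = inner x z + inner y z.
Proof. exact: (linearDl inner). Qed.

Lemma innerDr x y z : inner z (x + y) = inner z x + inner z y.
Proof. exact: (linearDr inner). Qed.

Lemma innerNl x z : inner (- x) z = - inner x z.
Proof. exact: (linearNl inner). Qed.

Lemma innerNr x z : inner z (- x) = - inner z x.
Proof. exact: (linearNr inner). Qed.

Lemma innerZl c x z : inner (c *: x) z = c * inner x z.
Proof. exact: (linearZl_LR inner). Qed.

Lemma innerZr c x z : inner z (c *: x) = c * inner z x.
Proof. by rewrite innerC innerZl innerC. Qed.

Lemma inner0l z : inner 0 z = 0.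
Proof. by rewrite -(scale0r 0) innerZl mul0r. Qed.

Lemma inner0r z : inner z 0 = 0.
Proof. by rewrite innerC inner0l. Qed.

Lemma inner_suml (I : Type) (s : seq I) (P : pred I) (f : I -> X) z :
  inner (\sum_(i <- s | P i) f i) z = \sum_(i <- s | P i) inner (f i) z.
Proof.
by apply: (big_morph (inner^~ z)) => [x y|]; rewrite ?innerDl ?inner0l.
Qed.

Lemma inner_sumr (I : Type) (s : seq I) (P : pred I) (f : I -> X) z :
  inner z (\sum_(i <- s | P i) f i) = \sum_(i <- s | P i) inner z (f i).
Proof. by rewrite innerC inner_suml; apply: eq_bigr => i _; rewrite innerC. Qed.

Definition innerE :=
  (innerDl, innerDr, innerNl, innerNr, innerZl, innerZr, inner0l, inner0r).

Lemma normE x : `|x| ^+ 2 = inner x x.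
Proof. by rewrite inner_normE. Qed.

Lemma inner_ge0 x : 0 <= inner x x.
Proof. by rewrite -normE exprn_ge0. Qed.

Lemma inner_eq0 x : inner x x = 0 -> x = 0.
Proof. by move/eqP; rewrite -normE sqrf_eq0 normr_eq0 => /eqP. Qed.

(** Weighted Young inequality: expand [|c x - y|^2 >= 0]. *)
Lemma young c x y : 0 < c -> 2 * inner x y <= c * inner x x + c^-1 * inner y y.
Proof.
move=> c0; rewrite -(ler_pM2l c0).
have := inner_ge0 (c *: x - y).
rewrite !innerE (innerC y x).
have -> : c * (c * inner x x + c^-1 * inner y y) =
  c ^+ 2 * inner x x + inner y y by field; rewrite gt_eqF.
lra.
Qed.

Lemma inner_ext x y : (forall h, inner x h = inner y h) -> x = y.
Proof.
move=> xy; apply/eqP; rewrite -subr_eq0; apply/eqP/inner_eq0.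
by rewrite innerDl innerNl xy subrr.
Qed.

Lemma cauchy_schwarz x y : inner x y <= `|x| * `|y|.
Proof.
have [->|x0] := eqVneq x 0; first by rewrite inner0l normr0 mul0r.
have [->|y0] := eqVneq y 0; first by rewrite inner0r normr0 mulr0.
have nx : 0 < `|x| by rewrite normr_gt0.
have ny : 0 < `|y| by rewrite normr_gt0.
have := @young (`|y| / `|x|) x y (divr_gt0 ny nx).
have -> : `|y| / `|x| * inner x x + (`|y| / `|x|)^-1 * inner y y
    = 2 * (`|x| * `|y|).
  by rewrite -!normE; field; rewrite !gt_eqF.
lra.
Qed.

Lemma normB_le x y : `|x| ^+ 2 <= 2 * `|y| ^+ 2 + 2 * `|x - y| ^+ 2.
Proof.
rewrite !normE.
have := inner_ge0 (x - 2 *: y).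
rewrite !innerE (innerC y x); lra.
Qed.

End InnerProduct.

Section FiniteDimension.
Context {R : realType} {X : finHilbertType R}.

Local Notation basis := (vbasis (fullv : {vspace X})).

(** The frame operator of the basis, the sum of the rank-one operators
    [b_i b_i^*]. *)
Definition frame_op (g : X) : X :=
  \sum_(i < \dim (fullv : {vspace X})) inner basis`_i g *: basis`_i.

Lemma frame_op_linear : linear frame_op.
Proof.
move=> c x y; rewrite /frame_op scaler_sumr -big_split /=.
by apply: eq_bigr => i _; rewrite innerDr innerZr scalerDl scalerA.
Qed.

HB.instance Definition _ := GRing.isLinear.Build R X X _ frame_op frame_op_linear.

Lemma frame_op_selfadjoint (g h : X) :
  inner (frame_op g) h = inner g (frame_op h).
Proof.
rewrite inner_suml inner_sumr; apply: eq_bigr => i _.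
by rewrite innerZl innerZr (innerC g) mulrC.
Qed.

Lemma frame_op_inj : injective frame_op.
Proof.
apply: raddf_inj => g Tg0; apply: inner_eq0.
have gb (i : nat) : inner basis`_i g = 0.
  have /eqP : inner (frame_op g) g = 0 by rewrite Tg0 inner0l.
  rewrite inner_suml psumr_eq0 => [|j _]; last by rewrite innerZl -expr2 sqr_ge0.
  have [ilt|ige _] := ltnP i (\dim (fullv : {vspace X})); last first.
    by rewrite nth_default ?inner0l // size_tuple.
  move/allP => /(_ (Ordinal ilt)); rewrite mem_index_enum => /(_ isT) /=.
  by rewrite innerZl mulf_eq0 orbb => /eqP.
rewrite [X in inner X g](coord_vbasis (memvf g)) inner_suml big1 // => i _.
by rewrite innerZl gb mulr0.
Qed.

(** Riesz representation.  [frame_op] is injective, hence bijective in finite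
    dimension, and self-adjoint; so the representative of [f] is the preimage
    under [frame_op] of the combination of the basis with weights [f b_i]. *)
Lemma riesz (f : X -> R) : linear (f : X -> R^o) ->
  exists g, forall h, f h = inner g h.
Proof.
move=> flin.
pose fL := HB.pack_for {linear X -> R^o} f (GRing.isLinear.Build _ _ _ _ _ flin).
have T0 : lker (linfun frame_op) == 0%VS.
  by apply/lker0P => x y; rewrite !lfunE => /frame_op_inj.
have Tsurj y : exists x, frame_op x = y.
  exists ((linfun frame_op)^-1%VF y).
  by rewrite -[LHS](lfunE frame_op) (lker0_lfunVK T0).
have [g gE] := Tsurj (\sum_(i < \dim (fullv : {vspace X})) f basis`_i *: basis`_i).
exists g => h; have [h' <-] := Tsurj h.
rewrite -frame_op_selfadjoint gE inner_suml.
rewrite -[f]/(fL : X -> R) linear_sum; apply: eq_bigr => i _.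
by rewrite linearZ innerZl /= mulrC.
Qed.

End FiniteDimension.

Section Adjoint.
Context {R : realType} {X Y : finHilbertType R}.

Lemma adjointE (K : {linear X -> Y}) y x :
  inner (K x) y = inner x (adjoint K y).
Proof.
have ex : exists g, forall x', inner (K x') y = inner g x'.
  apply: (@riesz R X (fun x' => inner (K x') y)) => c a b.
  by rewrite linearP innerDl innerZl.
rewrite /adjoint; case: xgetP => [g _ gE|/forallNP].
  by rewrite gE.
by case; case: ex => g gE; exists g => x'; rewrite gE innerC.
Qed.

Lemma adjoint_linear (K : {linear X -> Y}) : linear (adjoint K).
Proof.
move=> c y z; apply: inner_ext => h.
by rewrite !innerE ![inner _ h]innerC -!adjointE !innerE.
Qed.

Lemma adjointB (K : {linear X -> Y}) y z :
  adjoint K (y - z) = adjoint K y - adjoint K z.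
Proof.
by apply: inner_ext => h; rewrite !innerE ![inner _ h]innerC -!adjointE !innerE.
Qed.

(** The coordinates in a basis are linear functionals, hence inner products
    with fixed vectors, which Cauchy-Schwarz bounds. *)
Lemma linear_bounded (K : X -> Y) : linear K ->
  exists2 C, 0 <= C & forall x, `|K x| <= C * `|x|.
Proof.
move=> Klin.
pose KL := HB.pack_for {linear X -> Y} K (GRing.isLinear.Build _ _ _ _ _ Klin).
pose b := vbasis (fullv : {vspace X}).
have exg i : {g : X | forall x, coord b i x = inner g x}.
  by apply/cid/riesz => c u v; rewrite linearP.
exists (\sum_i `|sval (exg i)| * `|K b`_i|).
  by apply: sumr_ge0 => i _; rewrite mulr_ge0.
move=> x; rewrite {1}(coord_vbasis (memvf x)).
rewrite -[K]/(KL : X -> Y) linear_sum (le_trans (ler_norm_sum _ _ _))//.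
rewrite mulr_suml; apply: ler_sum => i _.
rewrite linearZ normrZ mulrAC ler_wpM2r//.
rewrite (svalP (exg i)) ler_norml cauchy_schwarz andbT lerNl -innerNl.
by rewrite (le_trans (cauchy_schwarz _ _))// normrN.
Qed.

Lemma opnormP (K : X -> Y) : linear K -> forall x, `|K x| <= opnorm K * `|x|.
Proof.
move=> Klin x.
pose KL := HB.pack_for {linear X -> Y} K (GRing.isLinear.Build _ _ _ _ _ Klin).
have [C C0 CK] := linear_bounded K Klin.
have [->|x0] := eqVneq x 0.
  by rewrite -[K]/(KL : X -> Y) linear0 !normr0 mulr0.
have nx : 0 < `|x| by rewrite normr_gt0.
rewrite -ler_pdivrMr //.
apply: ub_le_sup.
  exists C => _ [z /= z1 <-]; rewrite (le_trans (CK z))//.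
  by rewrite -[leRHS]mulr1 ler_wpM2l.
exists (`|x|^-1 *: x) => /=.
  by rewrite normrZ normfV normr_id mulVf ?gt_eqF.
by rewrite -[K]/(KL : X -> Y) linearZ normrZ normfV normr_id mulrC.
Qed.

End Adjoint.

(** * Subgradients, conjugates and proximal points *)

(** Every first-order argument below divides by a small [t] and lets it tend to
    0; this is the limit they share. *)
Lemma ler_of_addMsmall (R : realFieldType) (a b c : R) :
  (forall t, 0 < t < 1 -> a <= b + t * c) -> a <= b.
Proof.
move=> abc; apply/ler_addgt0Pr => e e0.
pose t := Num.min 2^-1 (e / (`|c| + 1)).
have c1 : 0 < `|c| + 1 by rewrite ltr_wpDl.
have t0 : 0 < t by rewrite lt_min invr_gt0 ltr0n divr_gt0.
have t1 : t < 1 by rewrite gt_min invf_lt1 ?ltr1n.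
apply: (le_trans (abc t _)); first by rewrite t0.
rewrite lerD2l (le_trans (ler_norm _))// normrM gtr0_norm//.
apply: (@le_trans _ _ (t * (`|c| + 1))); first by rewrite ler_pM2l// lerDl.
by rewrite -ler_pdivlMr// ge_min lexx orbT.
Qed.

Section Subgradients.
Context {R : realType} {X : finHilbertType R}.
Implicit Types (f : X -> \bar R) (x y v w : X).

Lemma subdiff_fin f x v : proper_fun f -> subdiff f x v -> f x \is a fin_num.
Proof.
move=> [fNy [y fy]] fxv; rewrite fin_numE fNy /=.
apply/eqP => fxE; have := fxv y; rewrite fxE /= leye_eq.
by rewrite (negPf fy).
Qed.

(** Comparing [f] at [x + t (y - x)] from below by the subgradient and from
    above by strong convexity, dividing by [t] and letting [t] tend to 0. *)
Lemma subdiff_strong mu f x v : proper_fun f -> strongly_convex_fun mu f ->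
  subdiff f x v ->
  forall y, (f x + (inner v (y - x) + mu / 2 * `|y - x| ^+ 2)%:E <= f y)%E.
Proof.
move=> fp fmu fxv y.
have fxfin := subdiff_fin f x v fp fxv.
have [fNy _] := fp.
case fyE : (f y) => [b| |]; last by have := fNy y; rewrite fyE.
  2: by rewrite leey.
move: fxfin fxv fmu; case fxE : (f x) => [a| |]// _ fxv fmu.
rewrite -EFinD lee_fin addrA -lerBrDr.
apply: (@ler_of_addMsmall _ _ _ (mu / 2 * `|y - x| ^+ 2)) => t /andP[t0 t1].
have := fmu y x t; rewrite (ltW t0) (ltW t1) => /(_ isT).
rewrite fxE fyE -!EFinB -!EFinM -EFinD => conv.
have := fxv (t *: y + (1 - t) *: x); rewrite fxE.
have fin : f (t *: y + (1 - t) *: x) \is a fin_num.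
  rewrite fin_numE fNy /=; apply/eqP => E; by rewrite E in conv.
move: conv; rewrite -(fineK fin) -!EFinD !lee_fin.
set d := fine _ => conv sub.
rewrite -(ler_pM2l t0).
move: conv sub; rewrite !normE !innerE (innerC x y) => conv sub.
nra.
Qed.

Lemma subdiff_strong_mono mu f x y v w : proper_fun f ->
  strongly_convex_fun mu f -> subdiff f x v -> subdiff f y w ->
  mu * `|x - y| ^+ 2 <= inner (v - w) (x - y).
Proof.
move=> fp fmu fxv fyw.
have := subdiff_strong _ _ _ _ fp fmu fxv y.
have := subdiff_strong _ _ _ _ fp fmu fyw x.
have := subdiff_fin _ _ _ fp fxv; have := subdiff_fin _ _ _ fp fyw.
case: (f x) => [a| |]//; case: (f y) => [b| |]// _ _.
rewrite -!EFinD !lee_fin (distrC y) !innerE; lra.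
Qed.

(** Equality case of the Fenchel-Young inequality: the supremum defining the
    conjugate at [v] is attained at [x], so [x] supports the conjugate there. *)
Lemma subdiff_conjugate f x v : f x \is a fin_num -> subdiff f x v ->
  conjugate f v = ((inner x v)%:E - f x)%E /\ subdiff (conjugate f) v x.
Proof.
move=> fxfin fxv.
have cE : conjugate f v = ((inner x v)%:E - f x)%E.
  apply/eqP; rewrite eq_le; apply/andP; split; last first.
    by apply: ereal_sup_ubound; exists x.
  apply: ge_ereal_sup => _ [y _ <-]; have := fxv y.
  move: fxfin; case: (f x) => [a| |]// _; case: (f y) => [b| |].
  - by rewrite -!EFinB -EFinD !lee_fin !innerE !(innerC v); lra.
  - by rewrite addeNy leNye.
  - by rewrite -EFinD leeNy_eq.
split=> // w; rewrite cE.
have : ((inner x w)%:E - f x <= conjugate f w)%E.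
  by apply: ereal_sup_ubound; exists x.
apply: le_trans.
move: fxfin; case: (f x) => [a| |]// _.
by rewrite -!EFinB -EFinD lee_fin !innerE; lra.
Qed.

(** The optimality condition of the proximal problem determines [prox]: by
    1-strong convexity of the quadratic term, the objective at any other point
    [y] exceeds its value at [s] by at least [|y - s|^2 / 2]. *)
Lemma proxP f c w s : f s \is a fin_num -> 0 < c ->
  subdiff f s (c^-1 *: (w - s)) -> prox (fun z => (c%:E * f z)%E) w = s.
Proof.
move=> fsfin c0 fs.
have key y : (c%:E * f s + (2^-1 * `|w - s| ^+ 2)%:E + (2^-1 * `|y - s| ^+ 2)%:E
   <= c%:E * f y + (2^-1 * `|w - y| ^+ 2)%:E)%E.
  have := fs y; move: fsfin; case: (f s) => [a| |]// _.
  case: (f y) => [b| |]//=; last first.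
    by move=> _; rewrite gt0_muley ?lte_fin// addye ?leey.
  rewrite -!EFinM -!EFinD !lee_fin -(ler_pM2l c0) mulrDr innerZl.
  rewrite mulVKf ?gt_eqF// !normE !innerE.
  by rewrite (innerC y w) (innerC s w) (innerC y s); lra.
rewrite /prox; case: xgetP => [y _ /(_ s) ymin|/forallNP].
  have := le_trans (key y) ymin.
  move: fsfin; case: (f s) => [a| |]// _; rewrite -!EFinM -!EFinD lee_fin => h.
  apply/eqP; rewrite -subr_eq0 -normr_eq0 -sqrf_eq0 eq_le.
  by rewrite exprn_ge0// andbT; lra.
case; exists s => y; apply: le_trans (key y).
move: fsfin; case: (f s) => [a| |]// _; rewrite -!EFinM -!EFinD lee_fin.
by have := exprn_ge0 2 (normr_ge0 (y - s)); lra.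
Qed.

End Subgradients.

(** * Convex functions with Lipschitz gradient *)

Section SmoothConvex.
Context {R : realType} {X : finHilbertType R}.
Variables (L : R) (f : X -> R).
Hypotheses (L_gt0 : 0 < L) (f_smooth : smooth_fun L f).
Implicit Types (x y v w : X).

Lemma gradE x h : 'd f x h = inner (grad f x) h.
Proof.
rewrite /grad; case: xgetP => [g _ ->//|/forallNP].
have [g gE] : exists g, forall h, 'd f x h = inner g h.
  by apply: (@riesz R X ('d f x)) => c a b; rewrite linearP.
by case; exists g.
Qed.

Lemma grad_lip x y : `|grad f x - grad f y| <= L * `|x - y|.
Proof. by have [_ /(_ (x, y))] := f_smooth; apply. Qed.

Lemma is_derive_line x h (t : R) :
  is_derive (t : R^o) 1 (fun s : R^o => f (x + s *: h) : R^o)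
    (inner (grad f (x + t *: h)) h).
Proof.
have [df _] := f_smooth.
have lineE : (fun k : R => k^-1 *: (((fun s : R^o => f (x + s *: h) : R^o) \o
      shift t) (k *: (1 : R^o)) - f (x + t *: h))) =
    (fun k : R => k^-1 *: ((f \o shift (x + t *: h)) (k *: h) - f (x + t *: h))).
  apply/funext => k /=; congr (_ *: (f _ - _)).
  by rewrite [k *: 1]mulr1 scalerDl addrCA addrA addrAC addrC addrA.
apply: DeriveDef.
  by rewrite /derivable lineE; apply: diff_derivable.
by rewrite /derive lineE -gradE -deriveE.
Qed.

(** The derivative of the difference of the two sides along the segment is
    nonpositive, by the Lipschitz bound on the gradient. *)
Lemma descent x y :
  f y <= f x + inner (grad f x) (y - x) + L / 2 * `|y - x| ^+ 2.
Proof.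
set h := y - x; set g := grad f x.
pose psi : R^o -> R^o := (fun t : R^o => f (x + t *: h) : R^o)
  - (inner g h \*: (@id R^o)) - (L / 2 * `|h| ^+ 2) \*: ((@id R^o) ^+ 2).
pose dpsi (t : R) : R := inner (grad f (x + t *: h)) h - inner g h
  - L / 2 * `|h| ^+ 2 * (2 * t).
have dpsiE (t : R^o) : is_derive t 1 psi (dpsi t).
  rewrite /psi; have lineD := is_derive_line x h t.
  apply: is_derive_eq.
  rewrite /dpsi; move: (inner _ h) (inner _ h) (_ / 2 * _) => a b c.
  by rewrite /GRing.scale /= expr1; ring.
have psiE (t : R) :
  psi t = f (x + t *: h) - t * inner g h - L / 2 * `|h| ^+ 2 * t ^+ 2.
  by rewrite mulrC.
have [|t t01 e] := @MVT_segment R psi dpsi 0 1 ler01 (fun t _ => dpsiE t).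
  by apply: derivable_within_continuous => t _; exact: ex_derive.
rewrite !psiE subr0 mulr1 scale1r scale0r addr0 [x + h]addrC subrK in e.
have t0 : 0 <= t by move: t01; rewrite in_itv /= => /andP[].
have gl : inner (grad f (x + t *: h) - g) h <= L * t * `|h| ^+ 2.
  rewrite (le_trans (cauchy_schwarz _ _))// expr2 mulrA ler_wpM2r//.
  rewrite (le_trans (grad_lip _ _))// addrC addKr normrZ ger0_norm// mulrA//.
move: gl e; rewrite innerDl innerNl /dpsi -/g.
move: (inner (grad _ _) h) (inner g h) (`|h| ^+ 2) (f y) (f x) => a b c d e.
lra.
Qed.

(** A subgradient and the gradient bound [f] from below and from above near
    [x]; the quadratic term vanishes to first order. *)
Lemma subdiff_grad x v : subdiff (EFin \o f) x v -> v = grad f x.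
Proof.
move=> fxv; apply/eqP; rewrite -subr_eq0; apply/eqP/inner_eq0.
set h := v - grad f x.
apply/eqP; rewrite eq_le inner_ge0 andbT.
apply: (@ler_of_addMsmall _ _ _ (L / 2 * `|h| ^+ 2)) => t /andP[t0 _].
have := fxv (x + t *: h); rewrite -EFinD lee_fin.
move/le_trans => /(_ _ (descent x (x + t *: h))).
rewrite [x + _ - x]addrAC subrr add0r !innerZr normrZ gtr0_norm// exprMn => le.
rewrite -(ler_pM2l t0).
have -> : inner h h = inner v h - inner (grad f x) h.
  by rewrite -innerNl -innerDl.
move: (inner v h) (inner (grad _ _) h) (`|h| ^+ 2) (f x) le => a b c d; lra.
Qed.

Hypothesis f_convex : convex_fun (EFin \o f).

(** Convexity bounds [f (x + t h)] from above, and the descent lemma based at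
    [x + t h] bounds it from below, up to a term quadratic in [t]. *)
Lemma grad_subdiff x : subdiff (EFin \o f) x (grad f x).
Proof.
move=> y; rewrite /= -EFinD lee_fin -lerBrDl.
set h := y - x.
apply: (@ler_of_addMsmall _ _ _ (3 / 2 * L * `|h| ^+ 2)) => t /andP[t0 t1].
have := f_convex y x t; rewrite (ltW t0) (ltW t1) => /(_ isT).
rewrite /= -!EFinM -EFinD lee_fin.
have -> : t *: y + (1 - t) *: x = x + t *: h.
  by rewrite scalerBl scale1r scalerBr addrC -addrA [- _ + _]addrC.
set z := x + t *: h => conv.
have lip : inner (grad f x - grad f z) h <= L * t * `|h| ^+ 2.
  rewrite (le_trans (cauchy_schwarz _ _))// expr2 mulrA ler_wpM2r//.
  rewrite (le_trans (grad_lip _ _))// distrC addrAC subrr add0r normrZ.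
  by rewrite gtr0_norm// mulrA.
have := descent z x.
have -> : x - z = - (t *: h) by rewrite opprD addrA subrr add0r.
move: conv lip; move: (f z) (grad f x) (grad f z) => fz gx gz conv lip.
rewrite normrN normrZ gtr0_norm// exprMn innerNr innerZr => desc.
rewrite -(ler_pM2l t0); move: conv desc lip; rewrite innerDl innerNl.
move: (inner gx h) (inner gz h) (`|h| ^+ 2) (f y) (f x).
move=> {z h} a b c d e; nra.
Qed.

(** Lower bound of a convex function by its tangent plus a multiple of the
    squared variation of the gradient: compare the tangent plane at [x] with
    the descent parabola at [y], at the minimizer [y - (g_y - g_x) / L] of
    their difference. *)
Lemma grad_lower_bound x y :
  f x + inner (grad f x) (y - x) + (2 * L)^-1 * `|grad f y - grad f x| ^+ 2
    <= f y.
Proof.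
pose z := y - L^-1 *: (grad f y - grad f x).
have := grad_subdiff x z; rewrite /= -EFinD lee_fin.
move/le_trans => /(_ _ (descent y z)).
have -> : z - y = - (L^-1 *: (grad f y - grad f x)) by rewrite addrAC subrr add0r.
have -> : z - x = (y - x) - L^-1 *: (grad f y - grad f x) by rewrite addrAC.
move: (grad f x) (grad f y) (f x) (f y) => {z} gx gy fx fy.
rewrite normrN normrZ normfV gtr0_norm// exprMn.
rewrite [inner gx (_ - _ *: _)]innerDr !innerNr !innerZr.
have -> : `|gy - gx| ^+ 2 = inner gy (gy - gx) - inner gx (gy - gx).
  by rewrite normE innerDl innerNl.
move: (inner gx (y - x)) (inner gy (gy - gx)) (inner gx (gy - gx)) => a b c.
have -> : L / 2 * (L^-1 ^+ 2 * (b - c)) = (2 * L)^-1 * (b - c).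
  by field; rewrite gt_eqF.
have -> : L^-1 = 2 * (2 * L)^-1 by field; rewrite gt_eqF.
lra.
Qed.

(** Baillon-Haddad: add the two lower bounds obtained by exchanging [x] and
    [y]; the function values cancel. *)
Lemma grad_cocoercive x y :
  L^-1 * `|grad f x - grad f y| ^+ 2 <= inner (grad f x - grad f y) (x - y).
Proof.
have := grad_lower_bound x y; have := grad_lower_bound y x.
move: (grad f x) (grad f y) (f x) (f y) => gx gy fx fy.
rewrite [`|gy - _|]distrC -[y - x]opprB innerNr innerDl innerNl.
have -> : L^-1 = 2 * (2 * L)^-1 by field; rewrite gt_eqF.
move: (inner gx _) (inner gy _) (`|_| ^+ 2) => a b c; lra.
Qed.

End SmoothConvex.

(** * Existence of proximal points *)

Section Resolvent.
Context {R : realType} {X : finHilbertType R}.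
Implicit Types (f : X -> \bar R) (s w x y v z : X).

Lemma convex_fun_fin f x y (a b t : R) : convex_fun f -> 0 <= t <= 1 ->
  (f x <= a%:E)%E -> (f y <= b%:E)%E ->
  (f (t *: x + (1 - t) *: y)%R <= (t * a + (1 - t) * b)%:E)%E.
Proof.
move=> fc /andP[t0 t1] fa fb; apply: (le_trans (fc x y t _)); first by rewrite t0.
rewrite [leRHS]EFinD (EFinM t) (EFinM (1 - t)).
by apply: leeD; apply: lee_wpmul2l; rewrite ?lee_fin ?subr_ge0.
Qed.

Lemma parallelogram_mid w x y :
  `|w - (2^-1 *: x + (1 - 2^-1) *: y)| ^+ 2 =
  2^-1 * `|w - x| ^+ 2 + 2^-1 * `|w - y| ^+ 2 - 4^-1 * `|x - y| ^+ 2.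
Proof.
rewrite !normE !innerE (innerC x w) (innerC y w) (innerC y x).
by field.
Qed.

Section Minimization.
Variables (f : X -> \bar R) (c : R) (w : X).
Hypotheses (f_proper : proper_fun f) (f_closed : closed_fun f).
Hypotheses (f_convex : convex_fun f) (c_gt0 : 0 < c).
Variables (x0 v0 : X).
Hypothesis x0v0 : subdiff f x0 v0.

(** The objective is described by upper bounds [t] of [f z], so that its values
    are real even where [f] is infinite. *)
Let values : set R :=
  [set r | exists z t, (f z <= t%:E)%E /\ r = t + c / 2 * `|w - z| ^+ 2].
Let m := inf values.

Local Lemma values_inf : has_inf values.
Proof.
have x0fin := subdiff_fin _ _ _ f_proper x0v0.
split.
  by exists (fine (f x0) + c / 2 * `|w - x0| ^+ 2), x0, (fine (f x0)); rewrite fineK.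
exists (fine (f x0) + inner v0 (w - x0) - c^-1 / 2 * `|v0| ^+ 2).
move=> _ [z [t [ft ->]]]; have := le_trans (x0v0 z) ft.
rewrite -(fineK x0fin) -EFinD lee_fin fineK//.
move: (fine _) => a; have := young c (w - z) v0 c_gt0.
rewrite (innerC _ v0) -!normE.
have -> : inner v0 (w - x0) = inner v0 (w - z) + inner v0 (z - x0).
  by rewrite -innerDr addrA subrK.
move: (inner v0 (w - z)) (inner v0 (z - x0)) => p q.
move: (`|_| ^+ 2) (`|_| ^+ 2) => d e; lra.
Qed.

Local Lemma inf_values_le z t :
  (f z <= t%:E)%E -> m <= t + c / 2 * `|w - z| ^+ 2.
Proof.
by move=> ft; apply: ge_inf; [have [] := values_inf | exists z, t].
Qed.

(** The midpoint of two near-minimizers cannot be better than the infimum,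
    while strong convexity would make it better if they were far apart. *)
Local Lemma near_minimizers_close e (x y : X) (a b : R) :
  (f x <= a%:E)%E -> (f y <= b%:E)%E ->
  a + c / 2 * `|w - x| ^+ 2 <= m + e -> b + c / 2 * `|w - y| ^+ 2 <= m + e ->
  `|x - y| ^+ 2 <= 8 / c * e.
Proof.
move=> fa fb xe ye.
have half01 : 0 <= (2^-1 : R) <= 1 by rewrite invr_ge0 ler0n invf_le1 ?ler1n.
have := inf_values_le _ _ (convex_fun_fin _ _ _ _ _ _ f_convex half01 fa fb).
rewrite parallelogram_mid; move: (`|x - y| ^+ 2) xe ye => d.
move: (`|w - x| ^+ 2) (`|w - y| ^+ 2) => p q xe ye le.
by rewrite mulrAC ler_pdivlMr//; nra.
Qed.

Local Lemma minimizer_exists :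
  exists s a, (f s <= a%:E)%E /\ a + c / 2 * `|w - s| ^+ 2 = m.
Proof.
have [zt ztP] : {zt : nat -> X * R & forall n, (f (zt n).1 <= (zt n).2%:E)%E /\
    (zt n).2 + c / 2 * `|w - (zt n).1| ^+ 2 <= m + harmonic n}.
  apply: (@choice nat (X * R)%type (fun n zt => (f zt.1 <= zt.2%:E)%E /\
    zt.2 + c / 2 * `|w - zt.1| ^+ 2 <= m + harmonic n)) => n.
  have hn : 0 < harmonic n :> R by rewrite /harmonic/= invr_gt0 ltr0n.
  have [_ [z [t [ft ->]]] lt] := inf_adherent hn values_inf.
  by exists (z, t); split => //; exact: ltW.
pose z n : X := (zt n).1.
have : cvg (z @ \oo).
  apply/cauchy_cvgP/cauchy_exP => e e0.
  have d0 : 0 < c / 8 * e ^+ 2 by rewrite mulr_gt0 ?exprn_gt0// divr_gt0.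
  have [N _ Nlt] := near_infty_natSinv_lt (PosNum d0).
  exists (z N), N => // n /= Nn; rewrite -ball_normE /=.
  rewrite -(ltr_pXn2r (n := 2)) ?nnegrE ?(ltW e0)//.
  apply: (le_lt_trans (near_minimizers_close (harmonic N) _ _ _ _ (ztP N).1
    (ztP n).1 (ztP N).2 _)).
    apply: (le_trans (ztP n).2); rewrite lerD2l /harmonic/= lef_pV2 ?posrE ?ltr0n//.
    by rewrite ler_nat ltnS.
  have := Nlt N (leqnn N); rewrite /= => lt.
  rewrite mulrAC ltr_pdivrMr// mulrC [ltRHS]mulrC.
  by move: lt; rewrite /harmonic /=; move: (_^-1) => h; lra.
move=> /cvg_ex[s zs].
(* [t n] bounds [f (z n)] and converges, whereas [(zt n).2] need not. *)
pose t n : R := m + harmonic n - c / 2 * `|w - z n| ^+ 2.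
exists s, (m - c / 2 * `|w - s| ^+ 2); split; last by rewrite subrK.
have ncvg : `|w - z n| @[n --> \oo] --> `|w - s|.
  by apply: cvg_norm; apply: cvgB => //; exact: cvg_cst.
have hcvg : m + harmonic n @[n --> \oo] --> m.
  rewrite -[X in _ --> X]addr0.
  exact: (cvgD (cvg_cst m) (@cvg_harmonic R)).
have tcvg : t @ \oo --> m - c / 2 * `|w - s| ^+ 2.
  exact: (cvgB hcvg (cvgM (cvg_cst _) (cvgM ncvg ncvg))).
have ztcvg : (z n, t n) @[n --> \oo] --> (s, m - c / 2 * `|w - s| ^+ 2).
  exact: (cvg_pair zs tcvg).
apply: (closed_cvg (epigraph f) f_closed _ _ ztcvg).
apply: nearW => n; rewrite /epigraph /=; have [ft le] := ztP n.
by apply: (le_trans ft); rewrite lee_fin lerBrDr.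
Qed.

(** Minty's surjectivity theorem: the inclusion is the optimality condition of
    the minimizer of [f + c/2 |w - .|^2].  It exists because near-minimizers of
    this strongly convex function form a Cauchy sequence, and the epigraph is
    closed; the affine minorant given by one subgradient bounds the function
    from below. *)
Lemma resolvent_exists : exists s, subdiff f s (c *: (w - s)).
Proof.
have [s [a [fa am]]] := minimizer_exists.
have sfin : f s \is a fin_num.
  rewrite fin_numE f_proper.1; apply/eqP => E; by rewrite E leye_eq in fa.
exists s => y.
case fyE : (f y) => [b| |]; [|by rewrite leey|by have := f_proper.1 y; rewrite fyE].
apply: (@le_trans _ _ (a + inner (c *: (w - s)) (y - s))%:E).
  by rewrite EFinD leeD2r.
rewrite lee_fin.
apply: (@ler_of_addMsmall _ _ _ (c / 2 * `|y - s| ^+ 2)) => t /andP[t0 t1].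
have t01 : 0 <= t <= 1 by rewrite !ltW.
have fb : (f y <= b%:E)%E by rewrite fyE.
have := inf_values_le _ _ (convex_fun_fin _ _ _ _ _ _ f_convex t01 fb fa).
rewrite -am => le; rewrite -(ler_pM2l t0); move: le.
have -> : w - (t *: y + (1 - t) *: s) = (w - s) - t *: (y - s).
  by rewrite scalerBl scale1r scalerBr addrCA opprD addrA.
move: (w - s) (y - s) => p q; rewrite !normE !innerE (innerC q p).
move: (inner p q) (inner p p) (inner q q) => d e g; lra.
Qed.

End Minimization.

Lemma prox_subdiff f c w : proper_fun f -> closed_fun f -> convex_fun f ->
  (exists x v, subdiff f x v) -> 0 < c ->
  let s := prox (fun z => (c%:E * f z)%E) w in subdiff f s (c^-1 *: (w - s)).
Proof.
move=> fp fcl fc [x [v fxv]] c0 /=.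
have cV : 0 < c^-1 by rewrite invr_gt0.
have [s fs] := resolvent_exists _ _ w fp fcl fc cV _ _ fxv.
by rewrite (proxP f c w s)//; exact: subdiff_fin fs.
Qed.

(** Moreau's decomposition: if [s] solves the resolvent inclusion of [h], then
    [w - c s] is a subgradient of [h] at [s], hence [s] is a subgradient of the
    conjugate at [w - c s], which is the optimality condition of the
    proximal step of the conjugate. *)
Lemma prox_conjugate_grad L (h : X -> R) c w : smooth_fun L h ->
  closed_fun (EFin \o h) -> convex_fun (EFin \o h) -> 0 < c ->
  let u := prox (fun v => (c%:E * conjugate (EFin \o h) v)%E) w in
  u = grad h (c^-1 *: (w - u)).
Proof.
move=> hs hcl hc c0 /=.
have hp : proper_fun (EFin \o h) by split=> //; exists 0.
have h0 := grad_subdiff _ _ hs hc 0.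
have [s hsv] := resolvent_exists _ _ (c^-1 *: w) hp hcl hc c0 _ _ h0.
have sE : s = c^-1 *: (w - c *: (c^-1 *: w - s)).
  have -> : c *: (c^-1 *: w - s) = w - c *: s.
    by rewrite scalerBr scalerA mulfV ?gt_eqF// scale1r.
  by rewrite opprB addrCA subrr addr0 scalerA mulVf ?gt_eqF// scale1r.
have [cE subc] := subdiff_conjugate (EFin \o h) _ _ isT hsv.
rewrite (proxP (conjugate (EFin \o h)) c w (c *: (c^-1 *: w - s)))//.
- by rewrite -sE; apply: (subdiff_grad _ _ hs).
- by rewrite cE.
- by rewrite -sE.
Qed.

End Resolvent.

(** * The Lyapunov function *)

Section Lyapunov.
Context {R : realType} {M : nat} {X : finHilbertType R}.
Context {U : 'I_M -> finHilbertType R}.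
Variables (K : forall m, {linear X -> U m}) (omega : 'I_M -> R) (gamma eta : R).
Hypotheses (M_gt0 : (0 < M)%N) (omega_gt0 : forall m, 0 < omega m).
Hypotheses (gamma_gt0 : 0 < gamma) (eta_gt0 : 0 < eta).
Implicit Types (e : X) (w : forall m, U m).

Local Notation theta m := ((M%:R ^+ 2 * omega m)^-1).
Local Notation step m := (gamma / (M%:R * omega m)).

(** Apart from the points where the gradients are taken, the primal step
    depends on the dual variables only through this mean. *)
Definition dual_mean w : X := M%:R^-1 *: \sum_m adjoint (K m) (w m).

Definition dual_form w w' : R := \sum_m theta m * inner (w m) (w' m).

(** The squared norm of the deviation [(e, w)] from a solution in the metric of
    the algorithm.  For a single [m] it is [|e + a K^* w|^2 + a^2 (eta |w|^2 -
    |K^* w|^2)] with [a] the stepsize, where [|K^* w|^2] cancels.  In the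
    expanded form the [p_m] occur through [dual_mean] only, so that one
    function serves both lower bounds on [eta]. *)
Definition lyapunov e w : R :=
  inner e e + 2 * gamma * inner e (dual_mean w)
  + gamma ^+ 2 * eta * dual_form w w.

Let M_neq0 : M%:R != 0 :> R. Proof. by rewrite pnatr_eq0 -lt0n. Qed.
Let omega_neq0 m : omega m != 0. Proof. by rewrite gt_eqF. Qed.
Let theta_gt0 m : 0 < theta m.
Proof. by rewrite invr_gt0 mulr_gt0 ?exprn_gt0 ?ltr0n. Qed.

Lemma dual_meanB w w' :
  dual_mean (fun m => w m - w' m) = dual_mean w - dual_mean w'.
Proof.
rewrite /dual_mean -scalerBr -sumrB; congr (_ *: _).
by apply: eq_bigr => m _; rewrite adjointB.
Qed.

Lemma dual_formBl w w1 w2 :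
  dual_form (fun m => w1 m - w2 m) w = dual_form w1 w - dual_form w2 w.
Proof.
by rewrite -sumrB; apply: eq_bigr => m _; rewrite innerDl innerNl mulrBr.
Qed.

Lemma dual_formC w w' : dual_form w w' = dual_form w' w.
Proof. by apply: eq_bigr => m _; rewrite innerC. Qed.

(** Exact energy balance of one iteration.  The two hypotheses are the dual and
    the primal proximal inclusions after subtracting the optimality inclusions,
    with [s m], [r], [g] the variations of the dual argument, of the
    subgradient of the nonsmooth term and of the mean gradient. *)
Lemma lyapunov_descent e e' w w' (s : forall m, U m) (r g : X) :
  (forall m, s m = (gamma * eta / (M%:R * omega m)) *: (w m - w' m) + K m e) ->
  gamma *: r =
    e - gamma *: (dual_mean w' - dual_mean w) - gamma *: (g + dual_mean w') - e' ->
  lyapunov e w - lyapunov e' w' =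
    lyapunov (e - e') (fun m => w m - w' m)
    + 2 * gamma * (M%:R^-1 * \sum_m inner (w' m) (s m))
    + 2 * gamma * inner r e' + 2 * gamma * inner g e'.
Proof.
move=> sE rE.
have -> : M%:R^-1 * \sum_m inner (w' m) (s m) =
    gamma * eta * (dual_form w w' - dual_form w' w') + inner e (dual_mean w').
  rewrite innerZr inner_sumr /dual_form -sumrB !mulr_sumr -big_split /=.
  apply: eq_bigr => m _; rewrite sE innerDr innerZr innerDr innerNr.
  rewrite (innerC _ (K m e)) adjointE (innerC (w' m) (w m)).
  move: (inner (w m) _) (inner (w' m) _) (inner e _) => a b d.
  by field; rewrite M_neq0 omega_neq0.
have -> : 2 * gamma * inner r e' = 2 * inner (gamma *: r) e'.
  by rewrite innerZl mulrA.
rewrite rE /lyapunov dual_meanB !dual_formBl !(dual_formC _ (fun _ => _ - _)).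
rewrite !dual_formBl (dual_formC w' w).
move: (dual_mean w) (dual_mean w') => p p'.
move: (dual_form w w) (dual_form w w') (dual_form w' w') => a b d.
rewrite !innerE (innerC e' e) (innerC p e') (innerC p' e').
move: (inner e e) (inner e e') (inner e' e') (inner g e') => i1 i2 i3 i4.
move: (inner e p) (inner e p') (inner e' p) (inner e' p') => j1 j2 j3 j4.
ring.
Qed.

(** By nonnegativity at [(- e, w)], the cross term is at most the sum of the
    square terms. *)
Lemma lyapunov_le e w : (forall e w, 0 <= lyapunov e w) ->
  lyapunov e w <= 2 * inner e e + 2 * gamma ^+ 2 * eta * dual_form w w.
Proof.
move=> /(_ (- e) w); rewrite /lyapunov !innerE opprK; lra.
Qed.

Section SeparateNorms.
Hypothesis omega_sum : \sum_m omega m = 1.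
Hypothesis K_bound : forall m x, inner (K m x) (K m x) <= eta * inner x x.

(** Bounding an operator bounds its adjoint: Young's inequality applied to
    [|K^* y|^2 = <y, K K^* y>]. *)
Lemma adjoint_bound m y :
  inner (adjoint (K m) y) (adjoint (K m) y) <= eta * inner y y.
Proof.
have := young eta y (K m (adjoint (K m) y)) eta_gt0.
rewrite (innerC y) adjointE; have := K_bound m (adjoint (K m) y).
rewrite -(ler_pM2l (x := eta^-1)) ?invr_gt0// mulKf ?gt_eqF//.
move: (inner (adjoint _ _) _) => a; lra.
Qed.

(** The terms [|K_m^* w_m|^2] created by the squares on the left are absorbed by
    [eta |w_m|^2], for each [m] separately. *)
Lemma lyapunov_ge e w :
  \sum_m omega m * `|e + step m *: adjoint (K m) (w m)| ^+ 2 <= lyapunov e w.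
Proof.
have -> : lyapunov e w = \sum_m (omega m * inner e e
    + 2 * gamma * (M%:R^-1 * inner e (adjoint (K m) (w m)))
    + gamma ^+ 2 * eta * (theta m * inner (w m) (w m))).
  rewrite !big_split /= -mulr_suml omega_sum mul1r -!mulr_sumr.
  by rewrite /lyapunov innerZr inner_sumr.
apply: ler_sum => m _; rewrite normE !innerE (innerC _ e).
have := adjoint_bound m (w m).
rewrite -(ler_pM2l (theta_gt0 m)) -(ler_pM2l (exprn_gt0 2 gamma_gt0)).
move: (adjoint (K m) (w m)) => p.
move: (inner e e) (inner e p) (inner p p) (inner (w m) (w m)) => a b d f.
have -> : omega m * (a + step m * b + (step m * b + step m * (step m * d))) =
  omega m * a + 2 * gamma * (M%:R^-1 * b) + gamma ^+ 2 * (theta m * d).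
  by field; rewrite M_neq0 omega_neq0.
move: (theta m) (omega m) => t o; lra.
Qed.

End SeparateNorms.

Section JointNorm.
Hypothesis K_bound : forall x,
  \sum_m omega m * inner (K m x) (K m x) <= eta * inner x x.

(** Young's inequality for each [m], with weights [eta theta_m], bounds the norm
    of [dual_mean w] by duality with [x |-> (K m x)_m]. *)
Lemma dual_mean_bound w :
  inner (dual_mean w) (dual_mean w) <= eta * dual_form w w.
Proof.
set p := dual_mean w.
have pp : 2 * inner p p = \sum_m M%:R^-1 * (2 * inner (w m) (K m p)).
  rewrite {1}/p innerZl inner_suml mulrCA !mulr_sumr.
  by apply: eq_bigr => m _; rewrite (innerC (adjoint _ _)) -adjointE innerC.
have le : 2 * inner p p <=
    eta * dual_form w w + eta^-1 * \sum_m omega m * inner (K m p) (K m p).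
  rewrite pp /dual_form !mulr_sumr -big_split /=; apply: ler_sum => m _.
  have cm : 0 < eta / (M%:R * omega m) by rewrite divr_gt0 ?mulr_gt0 ?ltr0n.
  have := young _ (w m) (K m p) cm.
  rewrite -(ler_pM2l (x := M%:R^-1)) ?invr_gt0 ?ltr0n//; move/le_trans; apply.
  move: (inner _ _) (inner _ _) => a b.
  rewrite le_eqVlt; apply/orP; left; apply/eqP.
  by field; rewrite M_neq0 omega_neq0 gt_eqF.
have : eta^-1 * \sum_m omega m * inner (K m p) (K m p) <= inner p p.
  by rewrite mulrC ler_pdivrMr// mulrC.
move: le; move: (inner p p) (dual_form w w) (eta^-1 * _) => a b d; lra.
Qed.

Lemma lyapunov_ge0 e w : 0 <= lyapunov e w.
Proof.
have := dual_mean_bound w; rewrite -(ler_pM2l (exprn_gt0 2 gamma_gt0)).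
have := inner_ge0 (e + gamma *: dual_mean w).
rewrite /lyapunov !innerE (innerC _ e).
move: (dual_mean w) (dual_form w w) => p d.
move: (inner e e) (inner e p) (inner p p) => a b f; lra.
Qed.

End JointNorm.

End Lyapunov.

Section GradientStep.
Context {R : realType} {X : finHilbertType R}.

(** With the gradient step [y = d - a g], the right-hand side is
    [|e - y|^2 + |d|^2 - |y|^2], and cocoercivity makes this step contract:
    [|y|^2 <= (1 - b) |d|^2] where [b = (2 - a L) a mu].  The bound degenerates
    to nonnegativity if [mu = 0]. *)
Lemma gradient_step (a L mu : R) (d g e : X) :
  0 < a -> 0 < L -> a * L < 2 -> 0 <= mu ->
  L^-1 * `|g| ^+ 2 <= inner g d -> mu * `|d| ^+ 2 <= inner g d ->
  Num.min 1 ((2 - a * L) * a * mu) / 2 * `|e| ^+ 2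
    <= `|d - e| ^+ 2 + 2 * a * inner g e.
Proof.
move=> a0 L0 aL mu0 coco strong.
set b := (2 - a * L) * a * mu.
have b0 : 0 <= b by rewrite /b !mulr_ge0// ?subr_ge0// ltW.
pose y := d - a *: g.
have -> : `|d - e| ^+ 2 + 2 * a * inner g e =
    `|e - y| ^+ 2 + (`|d| ^+ 2 - `|y| ^+ 2).
  rewrite /y !normE !innerE (innerC e d) (innerC e g) (innerC d g).
  by move: (inner d d) (inner d e) => i1 i2; ring.
have yd : b * `|d| ^+ 2 <= `|d| ^+ 2 - `|y| ^+ 2.
  have -> : `|d| ^+ 2 - `|y| ^+ 2 = 2 * a * inner g d - a ^+ 2 * `|g| ^+ 2.
    rewrite /y !normE !innerE (innerC d g).
    by move: (inner d d) (inner g d) (inner g g) => i1 i2 i3; ring.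
  have gg : `|g| ^+ 2 <= L * inner g d by rewrite mulrC -ler_pdivrMr// mulrC.
  have {}gg := ler_wpM2l (exprn_ge0 2 (ltW a0)) gg.
  have f0 : 0 <= (2 - a * L) * a by rewrite mulr_ge0// ?subr_ge0 ltW.
  have {}strong := ler_wpM2l f0 strong.
  move: strong gg; rewrite /b => {coco}.
  move: (`|g| ^+ 2) (`|d| ^+ 2) (inner g d) => i1 i2 i3; lra.
have y_le : `|y| ^+ 2 <= `|d| ^+ 2.
  by rewrite -subr_ge0 (le_trans _ yd)// mulr_ge0// exprn_ge0.
have := normB_le e y.
have : 0 <= `|e - y| ^+ 2 by rewrite exprn_ge0.
have : 0 <= `|y| ^+ 2 by rewrite exprn_ge0.
have k1 : Num.min 1 b <= 1 by rewrite ge_min lexx.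
have kb : Num.min 1 b <= b by rewrite ge_min lexx orbT.
have k0 : 0 <= Num.min 1 b by rewrite le_min ler01.
move: (`|e| ^+ 2) (`|e - y| ^+ 2) (`|y| ^+ 2) (`|d| ^+ 2) yd y_le.
move: (Num.min 1 b) k1 kb k0 => k k1 kb k0 i1 i2 i3 i4 yd yl p3 p2 tri.
have h1 : k / 2 * i1 <= k / 2 * (2 * i3 + 2 * i2).
  by apply: ler_wpM2l => //; rewrite divr_ge0.
have h2 : k * i2 <= i2 by rewrite -[leRHS]mul1r ler_wpM2r.
have h3 : k * i3 <= b * i4 by apply: ler_pM.
move: h1 h2 h3 yd; move: (b * i4) => j; lra.
Qed.

End GradientStep.

(** [V] contracts by the factor [C / (1 + C) = 1 - rho].  Bounding [E] by the
    decrease of [V], and not by [V] itself, gives the exponent [k] for the index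
    [k + 1]. *)
Lemma geometric_decay (R : realFieldType) (V E : nat -> R) (kappa C : R) :
  0 < kappa -> 0 < C -> (forall k, 0 <= V k) ->
  (forall k, kappa * E k.+1 <= V k - V k.+1) ->
  (forall k, V k.+1 <= C * (V k - V k.+1)) ->
  exists rho c0 : R, [/\ 0 < rho <= 1, 0 < c0 &
    forall k, E k.+1 <= (1 - rho) ^+ k * c0].
Proof.
move=> kappa0 C0 V0 EV VC.
have C1 : 0 < 1 + C by rewrite ltr_wpDl.
exists (1 + C)^-1, (kappa^-1 * V 0%N + 1); split.
- by rewrite invr_gt0 C1 invf_le1// lerDl ltW.
- by rewrite ltr_wpDl// mulr_ge0// invr_ge0 ltW.
have qE : 1 - (1 + C)^-1 = C / (1 + C) by field; rewrite gt_eqF.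
have q0 : 0 <= 1 - (1 + C)^-1 by rewrite qE divr_ge0 // ltW.
have Vk k : V k <= (1 - (1 + C)^-1) ^+ k * V 0%N.
  elim: k => [|k IH]; first by rewrite expr0 mul1r.
  rewrite exprS -mulrA (le_trans _ (ler_wpM2l q0 IH))//.
  rewrite qE mulrAC ler_pdivlMr//; have := VC k; lra.
move=> k; have e1 : E k.+1 <= kappa^-1 * V k.
  rewrite mulrC ler_pdivlMr// mulrC; have := EV k; have := V0 k.+1; lra.
apply: (le_trans e1).
have kV : 0 <= kappa^-1 by rewrite invr_ge0 ltW.
apply: (le_trans (ler_wpM2l kV (Vk k))).
by rewrite mulrCA ler_wpM2l ?exprn_ge0// lerDl.
Qed.

(** * Coercivity and uniqueness of the minimizer *)

Section Instance.
Context {R : realType} {M : nat} {X : finHilbertType R}.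
Context {U : 'I_M -> finHilbertType R}.
Variables (K : forall m, {linear X -> U m}) (F : 'I_M -> X -> R).
Variables (h : forall m, U m -> R) (G : X -> \bar R).
Variables (LF muF omega : 'I_M -> R) (muG gamma eta : R).
Hypotheses (M_gt0 : (0 < M)%N) (omega_gt0 : forall m, 0 < omega m).
Hypotheses (omega_sum : \sum_m omega m = 1).
Hypotheses (gamma_gt0 : 0 < gamma) (eta_gt0 : 0 < eta).
Hypotheses (muF_ge0 : forall m, 0 <= muF m) (muG_ge0 : 0 <= muG).
Hypothesis mu_gt0 : 0 < muG \/ forall m, 0 < muF m.

Local Notation step m := (gamma / (M%:R * omega m)).
Local Notation lyap := (lyapunov K omega gamma eta).
Local Notation mean f := (M%:R^-1 *: \sum_m f m).

Let M_neq0 : M%:R != 0 :> R. Proof. by rewrite pnatr_eq0 -lt0n. Qed.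
Let MV_gt0 : 0 < M%:R^-1 :> R. Proof. by rewrite invr_gt0 ltr0n. Qed.
Let omega_neq0 m : omega m != 0. Proof. by rewrite gt_eqF. Qed.
Let step_gt0 m : 0 < step m.
Proof. by rewrite divr_gt0 ?mulr_gt0 ?ltr0n. Qed.

Lemma opnorms_bound : (forall m, opnorm (K m) ^+ 2 <= eta) ->
  forall m x, inner (K m x) (K m x) <= eta * inner x x.
Proof.
move=> Keta m x; rewrite -!normE.
apply: (@le_trans _ _ ((opnorm (K m) * `|x|) ^+ 2)).
  by apply: ler_pM => //; apply: opnormP => c y z; exact: linearP.
by rewrite exprMn ler_wpM2r ?exprn_ge0.
Qed.

(** The left-hand side is the quadratic form of the operator
    [sum_m omega_m K_m^* K_m]. *)
Lemma joint_opnorm_bound :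
  opnorm (fun z : X => \sum_m omega m *: adjoint (K m) (K m z)) <= eta ->
  forall x, \sum_m omega m * inner (K m x) (K m x) <= eta * inner x x.
Proof.
set S := fun z => _ => Seta x.
have Slin : linear S.
  move=> c y z; rewrite /S scaler_sumr -big_split /=; apply: eq_bigr => m _.
  by rewrite linearP adjoint_linear scalerDr !scalerA mulrC.
have -> : \sum_m omega m * inner (K m x) (K m x) = inner (S x) x.
  rewrite inner_suml; apply: eq_bigr => m _.
  by rewrite innerZl (innerC (adjoint _ _)) adjointE.
rewrite (le_trans (cauchy_schwarz _ _))// -normE expr2 mulrA ler_wpM2r//.
by rewrite (le_trans (opnormP _ Slin x))// ler_wpM2r.
Qed.

(** The form is at least the weighted sum of the [|d m - e'|^2], the squared
    distances from the next [xR] to the points where the gradients are taken.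
    So each [m] contributes the left-hand side of a gradient step of size
    [gamma / (M omega m)], which is coercive in [e'] as soon as [muF m > 0]. *)
Lemma lyapunov_coercive :
  (forall m x, inner (K m x) (K m x) <= eta * inner x x) ->
  (forall m, 0 < LF m) -> (forall m, step m * LF m < 2) ->
  exists2 kappa, 0 < kappa &
    forall (e e' : X) (w w' : forall m, U m) (g d : 'I_M -> X),
    (forall m, d m = e - step m *: (adjoint (K m) (w' m) - adjoint (K m) (w m))) ->
    (forall m, (LF m)^-1 * `|g m| ^+ 2 <= inner (g m) (d m)) ->
    (forall m, muF m * `|d m| ^+ 2 <= inner (g m) (d m)) ->
    kappa * `|e'| ^+ 2 <= lyap (e - e') (fun m => w m - w' m)
      + 2 * gamma * inner (mean g) e' + 2 * gamma * muG * `|e'| ^+ 2.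
Proof.
move=> K_bound LF0 stepLF.
pose k m := Num.min 1 ((2 - step m * LF m) * step m * muF m) / 2.
have f_gt0 m : 0 < (2 - step m * LF m) * step m.
  by rewrite mulr_gt0// subr_gt0.
have k_ge0 m : 0 <= omega m * k m.
  rewrite mulr_ge0 ?(ltW (omega_gt0 m))// divr_ge0// le_min ler01 /=.
  by rewrite mulr_ge0// ltW.
exists (\sum_m omega m * k m + 2 * gamma * muG).
  have [muG0|muF0] := mu_gt0.
    by apply: ltr_wpDl; [exact: sumr_ge0 | rewrite !mulr_gt0].
  apply: ltr_wpDr; first by rewrite !mulr_ge0// ltW.
  rewrite lt_neqAle [X in _ && X]sumr_ge0// andbT eq_sym psumr_neq0//.
  apply/hasP; exists (Ordinal M_gt0).
    exact: mem_index_enum.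
  by rewrite /= mulr_gt0// divr_gt0// lt_min ltr01 mulr_gt0.
move=> e e' w w' g d dE coco strong.
rewrite mulrDl lerD2r.
have low := lyapunov_ge K omega gamma eta M_gt0 omega_gt0 gamma_gt0 eta_gt0
  omega_sum K_bound (e - e') (fun m => w m - w' m).
apply: (le_trans _ (lerD low (lexx _))).
rewrite innerZl inner_suml !mulr_sumr -big_split /= mulr_suml.
apply: ler_sum => m _.
have -> : e - e' + step m *: adjoint (K m) (w m - w' m) = d m - e'.
  by rewrite dE adjointB -[adjoint _ (w m) - _]opprB scalerN addrAC.
have one := gradient_step _ _ _ _ _ e' (step_gt0 m) (LF0 m) (stepLF m)
  (muF_ge0 m) (coco m) (strong m).
rewrite -[omega m * _ * _]mulrA.
apply: (le_trans (ler_wpM2l (ltW (omega_gt0 m)) one)).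
move: (inner _ _) (`|d m - e'| ^+ 2) => a b.
rewrite le_eqVlt; apply/orP; left; apply/eqP.
by field; rewrite M_neq0 omega_neq0.
Qed.

Hypotheses (F_smooth : forall m, smooth_fun (LF m) (F m)).
Hypotheses (F_strong : forall m, strongly_convex_fun (muF m) (EFin \o F m)).
Hypotheses (F_convex : forall m, convex_fun (EFin \o F m)).
Hypotheses (G_proper : proper_fun G) (G_strong : strongly_convex_fun muG G).

Lemma EFin_proper (Y : finHilbertType R) (f : Y -> R) : proper_fun (EFin \o f).
Proof. by split => //; exists 0. Qed.

Lemma F_growth m x y : F m x + inner (grad (F m) x) (y - x)
  + muF m / 2 * `|y - x| ^+ 2 <= F m y.
Proof.
have := subdiff_strong _ _ _ _ (EFin_proper _ (F m)) (F_strong m)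
  (grad_subdiff _ _ (F_smooth m) (F_convex m) x) y.
by rewrite /= -EFinD lee_fin addrA.
Qed.

Lemma F_strong_mono m x y :
  muF m * `|x - y| ^+ 2 <= inner (grad (F m) x - grad (F m) y) (x - y).
Proof.
by apply: (subdiff_strong_mono _ _ _ _ _ _ (EFin_proper _ (F m)) (F_strong m));
  exact: grad_subdiff (F_smooth m) (F_convex m) _.
Qed.

Lemma objectiveE z : objective K F (fun m => EFin \o h m) G z =
  ((M%:R^-1 * \sum_m (F m z + h m (K m z)))%:E + G z)%E.
Proof. by rewrite /objective EFinM -sumEFin. Qed.

(** Add up the strong subgradient inequalities at [x]; the linear terms cancel
    by the optimality inclusion. *)
Lemma objective_growth x : optimality_inclusion K F (fun m => EFin \o h m) G x ->
  exists2 kappa, 0 < kappa & forall y,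
  (objective K F (fun m => EFin \o h m) G x + (kappa * `|y - x| ^+ 2)%:E
    <= objective K F (fun m => EFin \o h m) G y)%E.
Proof.
move=> [v [r [vP rP opt]]].
exists (M%:R^-1 * \sum_m (muF m / 2) + muG / 2).
  have sF : 0 <= \sum_m muF m / 2 by apply: sumr_ge0 => m _; rewrite divr_ge0.
  have [muG0|muF0] := mu_gt0.
    by apply: ltr_wpDl; [rewrite mulr_ge0// ltW | rewrite divr_gt0].
  apply: ltr_wpDr; first by rewrite divr_ge0.
  rewrite mulr_gt0// lt_neqAle sF andbT eq_sym.
  rewrite psumr_neq0 => [|m _]; last by rewrite divr_ge0.
  apply/hasP; exists (Ordinal M_gt0); first exact: mem_index_enum.
  by rewrite /= divr_gt0.
move=> y; rewrite !objectiveE.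
have Gg := subdiff_strong _ _ _ _ G_proper G_strong rP y.
have Gfin := subdiff_fin _ _ _ G_proper rP.
apply: (le_trans _ (leeD2l _ Gg)).
rewrite -(fineK Gfin) -!EFinD lee_fin.
have hh m : h m (K m x) + inner (adjoint (K m) (v m)) (y - x) <= h m (K m y).
  have := vP m (K m y); rewrite /= -EFinD lee_fin.
  by rewrite -linearB innerC adjointE innerC.
have sum_le : \sum_m (F m x + h m (K m x)) +
    inner (\sum_m (grad (F m) x + adjoint (K m) (v m))) (y - x) +
    (\sum_m muF m / 2) * `|y - x| ^+ 2 <= \sum_m (F m y + h m (K m y)).
  rewrite inner_suml mulr_suml -!big_split /=; apply: ler_sum => m _.
  have := hh m; have := F_growth m x y; rewrite innerDl.
  move: (inner _ _) (inner _ _) (`|_| ^+ 2) => a b d; lra.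
have := ler_wpM2l (ltW MV_gt0) sum_le.
have := congr1 (fun z => inner z (y - x)) opt.
rewrite innerDl innerZl inner0l.
move: (inner _ _) (inner _ _) (`|_| ^+ 2) (fine _) => a b d f.
move: (\sum_m _) (\sum_m _) (\sum_m _) (M%:R^-1) => s1 s2 s3 c; lra.
Qed.

Lemma objective_argmin x : optimality_inclusion K F (fun m => EFin \o h m) G x ->
  argmin (objective K F (fun m => EFin \o h m) G) = [set x].
Proof.
move=> opt; have [kappa kappa0 grow] := objective_growth x opt.
have [v [r [_ rP _]]] := opt.
have Gfin := subdiff_fin _ _ _ G_proper rP.
apply/seteqP; split => [y ymin|_ -> y].
  have := le_trans (grow y) (ymin x).
  rewrite objectiveE -(fineK Gfin) -!EFinD lee_fin gerDl pmulr_rle0//.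
  move=> le0; apply/eqP; rewrite -subr_eq0 -normr_eq0 -sqrf_eq0.
  by rewrite eq_le le0 exprn_ge0.
apply: le_trans (grow y); rewrite leeDl// lee_fin.
by rewrite mulr_ge0 ?exprn_ge0// ltW.
Qed.

(** A null function has null gradient, and strong monotonicity of a null map
    forces the space to be a point. *)
Lemma zero_strong_trivial m : 0 < muF m -> (forall z, F m z = 0) ->
  forall z : X, z = 0.
Proof.
move=> mu0 F0 z.
have g0 x : 0 = grad (F m) x.
  apply: (subdiff_grad _ _ (F_smooth m)) => y.
  by rewrite /= inner0l !F0 adde0.
have := F_strong_mono m z 0; rewrite -!g0 subrr inner0l subr0 pmulr_rle0// => le0.
by apply/eqP; rewrite -normr_eq0 -sqrf_eq0 eq_le le0 exprn_ge0.
Qed.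

End Instance.

(** * One iteration of the algorithm *)

Section Iteration.
Context {R : realType} {M : nat} {X : finHilbertType R}.
Context {U : 'I_M -> finHilbertType R}.
Variables (K : forall m, {linear X -> U m}) (F : 'I_M -> X -> R).
Variables (h : forall m, U m -> R) (G : X -> \bar R).
Variables (LH omega : 'I_M -> R) (muG gamma eta : R).
Hypotheses (M_gt0 : (0 < M)%N) (omega_gt0 : forall m, 0 < omega m).
Hypotheses (omega_sum : \sum_m omega m = 1).
Hypotheses (gamma_gt0 : 0 < gamma) (eta_gt0 : 0 < eta).
Hypotheses (G_proper : proper_fun G) (G_closed : closed_fun G).
Hypotheses (G_convex : convex_fun G) (G_strong : strongly_convex_fun muG G).
Hypotheses (h_closed : forall m, closed_fun (EFin \o h m)).
Hypotheses (h_convex : forall m, convex_fun (EFin \o h m)).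
Hypotheses (LH_gt0 : forall m, 0 < LH m).
Hypotheses (h_smooth : forall m, smooth_fun (LH m) (h m)).
Variables (xR : nat -> X) (u : nat -> forall m, U m) (p x a : nat -> 'I_M -> X).
Hypothesis run :
  pddy_run K F (fun m => EFin \o h m) G omega (fun=> gamma) eta xR u p x a.
Variables (xs : X) (v : forall m, U m) (rs : X).
Hypotheses (vP : forall m, subdiff (EFin \o h m) (K m xs) (v m)).
Hypotheses (rsP : subdiff G xs rs).
Hypotheses (opt :
  0 = M%:R^-1 *: (\sum_(m < M) (grad (F m) xs + adjoint (K m) (v m))) + rs).

Local Notation step m := (gamma / (M%:R * omega m)).
Local Notation lyap := (lyapunov K omega gamma eta).
Local Notation dmean := (dual_mean K).
Local Notation mean f := (M%:R^-1 *: \sum_m f m).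

Let M_neq0 : M%:R != 0 :> R. Proof. by rewrite pnatr_eq0 -lt0n. Qed.
Let omega_neq0 m : omega m != 0. Proof. by rewrite gt_eqF. Qed.

Lemma run_p k m : p k m = adjoint (K m) (u k m).
Proof. by case: k => [|k]; rewrite ?(pddy_p0 run) ?(pddy_p run). Qed.

Lemma run_x k m : x k.+1 m =
  xR k - step m *: (adjoint (K m) (u k.+1 m) - adjoint (K m) (u k m)).
Proof. by rewrite (pddy_x run) !run_p. Qed.

(** The point at which the dual proximal step evaluates the gradient of [h m]. *)
Let s k m := (gamma * eta / (M%:R * omega m)) *: (u k m - u k.+1 m) + K m (xR k).

Lemma run_u k m : u k.+1 m = grad (h m) (s k m).
Proof.
have c0 : 0 < M%:R * omega m / (gamma * eta).
  by rewrite divr_gt0 ?mulr_gt0 ?ltr0n.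
have := prox_conjugate_grad _ _ _ (u k m + (M%:R * omega m / (gamma * eta)) *:
  K m (xR k)) (h_smooth m) (h_closed m) (h_convex m) c0.
rewrite /= -(pddy_u run) => {1}->; congr (grad _ _).
rewrite addrAC scalerDr scalerA mulVf ?gt_eqF// scale1r /s; congr (_ *: _ + _).
by rewrite invf_div.
Qed.

Lemma run_a k : mean (a k) = xR k - gamma *: (dmean (u k.+1) - dmean (u k))
  - gamma *: (mean (fun m => grad (F m) (x k.+1 m)) + dmean (u k.+1)).
Proof.
have aE m : a k m = (M%:R * omega m) *: xR k
    - gamma *: (adjoint (K m) (u k.+1 m) - adjoint (K m) (u k m))
    - gamma *: (grad (F m) (x k.+1 m) + adjoint (K m) (u k.+1 m)).
  rewrite (pddy_a run) run_p [in X in X - _ - _]run_x scalerBr scalerA.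
  rewrite mulrCA divff ?mulr1 ?mulf_neq0//.
  by rewrite (scalerDr gamma (grad _ _)) opprD addrA.
apply: inner_ext => z; rewrite /dual_mean !innerE !inner_suml.
pose i1 m := inner (adjoint (K m) (u k.+1 m)) z.
pose i0 m := inner (adjoint (K m) (u k m)) z.
pose gi m := inner (grad (F m) (x k.+1 m)) z.
transitivity (M%:R^-1 * \sum_m (M%:R * inner (xR k) z * omega m
    - gamma * (i1 m - i0 m) - gamma * (gi m + i1 m))).
  congr (_ * _); apply: eq_bigr => m _; rewrite aE !innerE.
  by rewrite (mulrAC M%:R).
rewrite !sumrB -!mulr_sumr omega_sum sumrB big_split /=.
by field; rewrite M_neq0.
Qed.

Lemma run_xR k : subdiff G (xR k.+1) (gamma^-1 *: (mean (a k) - xR k.+1)).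
Proof.
rewrite (pddy_xR run); apply: prox_subdiff => //.
by exists xs, rs.
Qed.

Local Notation e k := (xR k - xs).
Local Notation w k := (fun m => u k m - v m).
Local Notation g k := (fun m => grad (F m) (x k.+1 m) - grad (F m) xs).

Lemma vE m : v m = grad (h m) (K m xs).
Proof. exact: subdiff_grad (h_smooth m) _ _ (vP m). Qed.

(** In the energy balance, the dual inclusion contributes the cocoercivity of
    the gradients of the smooth [h m], which controls the dual deviations, and
    the primal one the strong monotonicity of the subdifferential of [G]. *)
Lemma lyapunov_step k :
  lyap (e k - e k.+1) (fun m => w k m - w k.+1 m)
  + 2 * gamma * inner (mean (g k)) (e k.+1) + 2 * gamma * muG * `|e k.+1| ^+ 2
  + 2 * gamma * (M%:R^-1 * \sum_m (LH m)^-1 * `|w k.+1 m| ^+ 2)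
  <= lyap (e k) (w k) - lyap (e k.+1) (w k.+1).
Proof.
pose ds m := s k m - K m xs.
pose r := gamma^-1 *: (mean (a k) - xR k.+1) - rs.
have dsE m : ds m =
    (gamma * eta / (M%:R * omega m)) *: (w k m - w k.+1 m) + K m (e k).
  rewrite /ds /s (linearB (K m)) addrA; congr (_ *: _ + _ - _).
  by rewrite opprB addrA subrK.
have rE : gamma *: r = e k - gamma *: (dmean (w k.+1) - dmean (w k))
    - gamma *: (mean (g k) + dmean (w k.+1)) - e k.+1.
  rewrite /r; have -> : rs = - (mean (fun m => grad (F m) xs) + dmean v).
    apply/eqP; rewrite -addr_eq0 addrC /dual_mean -scalerDr -big_split /=.
    by rewrite -opt.
  have -> : mean (g k) = mean (fun m => grad (F m) (x k.+1 m))
      - mean (fun m => grad (F m) xs).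
    by rewrite -scalerBr -sumrB.
  rewrite run_a !dual_meanB opprK scalerDr scalerA mulfV ?gt_eqF// scale1r.
  move: (M%:R^-1 *: _) (M%:R^-1 *: _) (dmean _) (dmean _) (dmean _) => f1 f2 d1 d2 d3.
  apply: inner_ext => z; rewrite !innerE.
  move: (inner f1 z) (inner f2 z) (inner d1 z) (inner d2 z) (inner d3 z).
  by move: (inner _ z) (inner _ z) (inner _ z) => *; ring.
rewrite (lyapunov_descent K omega gamma eta M_gt0 omega_gt0 _ _ _ _ ds r _ dsE rE).
have mon_G : muG * `|e k.+1| ^+ 2 <= inner r (e k.+1).
  have := subdiff_strong_mono _ _ _ _ _ _ G_proper G_strong (run_xR k) rsP.
  by [].
have mon_H : \sum_m (LH m)^-1 * `|w k.+1 m| ^+ 2 <= \sum_m inner (w k.+1 m) (ds m).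
  apply: ler_sum => m _.
  have := grad_cocoercive _ _ (LH_gt0 m) (h_smooth m) (h_convex m) (s k m) (K m xs).
  by rewrite -run_u -vE.
have M0 : 0 <= M%:R^-1 :> R by rewrite invr_ge0.
have g2 : 0 <= 2 * gamma by rewrite mulr_ge0// ltW.
have := ler_wpM2l g2 mon_G; have := ler_wpM2l g2 (ler_wpM2l M0 mon_H).
rewrite mulrA [2 * gamma * (muG * _)]mulrA.
move: (2 * gamma * _ * _) (2 * gamma * _ * _) => q1 q2.
lra.
Qed.

(** The decrease controls [|e|^2] by the coercivity hypothesis and each
    [|w m|^2] by smoothness of [h m], that is, every term of the upper bound
    [lyapunov_le] of the next value of the Lyapunov function. *)
Lemma linear_rate kappa : 0 < kappa -> (forall e w, 0 <= lyap e w) ->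
  (forall k, kappa * `|e k.+1| ^+ 2 <=
    lyap (e k - e k.+1) (fun m => w k m - w k.+1 m)
    + 2 * gamma * inner (mean (g k)) (e k.+1)
    + 2 * gamma * muG * `|e k.+1| ^+ 2) ->
  exists rho c0 : R, [/\ 0 < rho <= 1, 0 < c0 &
    forall k, `|xR k.+1 - xs| ^+ 2 <= (1 - rho) ^+ k * c0].
Proof.
move=> kappa0 lyap_ge0 coer.
pose V k := lyap (e k) (w k).
pose dual k := 2 * gamma * (M%:R^-1 * \sum_m (LH m)^-1 * `|w k.+1 m| ^+ 2).
have decr k : kappa * `|e k.+1| ^+ 2 + dual k <= V k - V k.+1.
  by apply: (le_trans _ (lyapunov_step k)); rewrite lerD2r.
have LH_ge0 m : 0 <= (LH m)^-1 by rewrite invr_ge0 ltW.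
have dual_ge0 k : 0 <= dual k.
  apply: mulr_ge0; first by rewrite mulr_ge0// ltW.
  rewrite mulr_ge0 ?invr_ge0//; apply: sumr_ge0 => m _.
  by rewrite mulr_ge0 ?exprn_ge0.
pose D m := gamma * eta * LH m / (M%:R * omega m).
have D_ge0 m : 0 <= D m.
  by rewrite divr_ge0 ?mulr_ge0 ?ltW// ltr0n.
have sumD_ge0 : 0 <= \sum_m D m by exact: sumr_ge0.
(* [2 / kappa] is the ratio of the primal coefficients of the upper bound and of
   the decrease, and [D m] that of the dual coefficients at [m]. *)
pose C := 2 / kappa + \sum_m D m.
have C_gt0 : 0 < C by rewrite ltr_wpDr// divr_gt0.
apply: (geometric_decay R V (fun k => `|e k| ^+ 2) kappa C) => //.
- by move=> k; exact: lyap_ge0.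
- by move=> k; apply: (le_trans _ (decr k)); rewrite lerDl.
move=> k; apply: (@le_trans _ _ (C * (kappa * `|e k.+1| ^+ 2 + dual k))); last first.
  by apply: ler_wpM2l (decr k); exact: ltW.
apply: (le_trans (lyapunov_le _ _ _ _ _ _ lyap_ge0)).
rewrite -normE.
have primal_le : 2 * `|e k.+1| ^+ 2 <= C * (kappa * `|e k.+1| ^+ 2).
  have := exprn_ge0 2 (normr_ge0 (e k.+1)); move: (_ ^+ 2) => n n0.
  rewrite mulrA ler_wpM2r// /C mulrDl divfK ?gt_eqF// lerDl.
  by rewrite mulr_ge0// ltW.
have dual_le : 2 * gamma ^+ 2 * eta * dual_form omega (w k.+1) (w k.+1)
    <= C * dual k.
  rewrite /dual_form /dual !mulr_sumr; apply: ler_sum => m _.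
  have DC : D m <= C.
    apply: (@le_trans _ _ (\sum_m D m)); last by rewrite lerDr divr_ge0// ltW.
    by rewrite (bigD1 m)//= lerDl sumr_ge0.
  rewrite normE; apply: (le_trans _ (ler_wpM2r _ DC)); last first.
    rewrite !mulr_ge0 ?invr_ge0// ?inner_ge0// ltW//.
  rewrite le_eqVlt; apply/orP; left; apply/eqP; move: (inner _ _) => i.
  by rewrite /D; field; rewrite M_neq0 omega_neq0 gt_eqF.
by rewrite mulrDr lerD.
Qed.

End Iteration.

(** * Linear convergence *)

Theorem theorem11 (R : realType) (M : nat) (M_gt0 : (0 < M)%N)
  (X : finHilbertType R) (U : 'I_M -> finHilbertType R)
  (K : forall m, {linear X -> U m})
  (F : 'I_M -> X -> R) (H : forall m, U m -> \bar R) (G : X -> \bar R)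
  (LF muF LH omega : 'I_M -> R) (muG : R)
  (G_proper : proper_fun G) (G_closed : closed_fun G) (G_convex : convex_fun G)
  (H_proper : forall m, proper_fun (H m)) (H_closed : forall m, closed_fun (H m))
  (H_convex : forall m, convex_fun (H m))
  (F_convex : forall m, convex_fun (EFin \o F m))
  (LF_gt0 : forall m, 0 < LF m) (F_smooth : forall m, smooth_fun (LF m) (F m))
  (muF_ge0 : forall m, 0 <= muF m)
  (F_strong : forall m, strongly_convex_fun (muF m) (EFin \o F m))
  (muG_ge0 : 0 <= muG) (G_strong : strongly_convex_fun muG G)
  (omega_gt0 : forall m, 0 < omega m) (omega_sum : \sum_(m < M) omega m = 1)
  (solvable : exists x, optimality_inclusion K F H G x)
  (mu_gt0 : 0 < fam_min M_gt0 (fun m => muF m / (M%:R * omega m)) + muG)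
  (LH_gt0 : forall m, 0 < LH m)
  (H_fin : forall m v, H m v \is a fin_num)
  (H_smooth : forall m, smooth_fun (LH m) (fine \o H m))
  (gamma eta : R) (gamma_gt0 : 0 < gamma)
  (gamma_lt : gamma < 2 / fam_max M_gt0 (fun m => LF m / (M%:R * omega m)))
  (eta_gt0 : 0 < eta)
  (eta_ge : fam_max M_gt0 (fun m => opnorm (K m) ^+ 2) <= eta \/
    (forall m z, F m z = 0) /\
    opnorm (fun z : X => \sum_(m < M) omega m *: adjoint (K m) (K m z)) <= eta)
  (xR : nat -> X) (u : nat -> forall m, U m) (p x a : nat -> 'I_M -> X)
  (run : pddy_run K F H G omega (fun=> gamma) eta xR u p x a) :
  exists2 xstar : X, argmin (objective K F H G) = [set xstar] &
    exists rho c0 : R, [/\ 0 < rho <= 1, 0 < c0 &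
      forall k : nat, `|xR k.+1 - xstar| ^+ 2 <= (1 - rho) ^+ k * c0].
Proof.
have [h hE] : exists h : forall m, U m -> R, H = fun m => EFin \o h m.
  exists (fun m => fine \o H m); apply: functional_extensionality_dep => m.
  by apply/funext => z; rewrite /= fineK.
subst H.
have {}H_smooth m : smooth_fun (LH m) (h m) := H_smooth m.
have M0 : 0 < M%:R :> R by rewrite ltr0n.
have c_gt0 m : 0 < M%:R * omega m by rewrite mulr_gt0.
have mu_pos : 0 < muG \/ forall m, 0 < muF m.
  have [muG0|muG0] := eqVneq muG 0; last by left; rewrite lt_neqAle eq_sym muG0.
  right=> m; move: mu_gt0; rewrite muG0 addr0 => /lt_le_trans.
  move=> /(_ _ (bigmin_le _ m _)); rewrite /= pmulr_lgt0// invr_gt0//.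
have step_LF m : gamma / (M%:R * omega m) * LF m < 2.
  have LFm := le_bigmax (LF (Ordinal M_gt0) / (M%:R * omega (Ordinal M_gt0)))
    (fun m => LF m / (M%:R * omega m)) m.
  have max_gt0 : 0 < fam_max M_gt0 (fun m => LF m / (M%:R * omega m)).
    by apply: lt_le_trans LFm; rewrite divr_gt0.
  rewrite -mulrA (mulrC _ (LF m)); move: gamma_lt; rewrite ltr_pdivlMr//.
  by apply: le_lt_trans; rewrite ler_wpM2l// ltW.
have [xs opt] := solvable.
exists xs.
  exact: (objective_argmin K F h G LF muF muG M_gt0 muF_ge0 muG_ge0 mu_pos
    F_smooth F_strong F_convex G_proper G_strong xs opt).
have [v [rs [vP rsP optE]]] := opt.
have rate := linear_rate K F h G LH omega muG gamma eta M_gt0 omega_gt0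
  omega_sum gamma_gt0 eta_gt0 G_proper G_closed G_convex G_strong H_closed
  H_convex LH_gt0 H_smooth xR u p x a run xs v rs vP rsP optE.
(* The second bound on [eta] controls only the mean of the [p_m], not each
   [x_m - xR]; it suffices there because no gradient has to be absorbed. *)
have [K_le|[F0 S_le]] := eta_ge.
  have K_bound : forall m z, inner (K m z) (K m z) <= eta * inner z z.
    apply: opnorms_bound => m; apply: le_trans K_le.
    exact: (le_bigmax _ (fun m => opnorm (K m) ^+ 2) m).
  have [kappa kappa0 coer] := lyapunov_coercive K LF muF omega muG gamma eta M_gt0
    omega_gt0 omega_sum gamma_gt0 eta_gt0 muF_ge0 muG_ge0 mu_pos K_bound LF_gt0
    step_LF.
  apply: (rate kappa kappa0) => [e w|k].
    apply: le_trans (lyapunov_ge K omega gamma eta M_gt0 omega_gt0 gamma_gt0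
      eta_gt0 omega_sum K_bound e w).
    by apply: sumr_ge0 => m _; rewrite mulr_ge0 ?exprn_ge0// ltW.
  have dE m : x k.+1 m - xs = xR k - xs - (gamma / (M%:R * omega m)) *:
      (adjoint (K m) (u k.+1 m - v m) - adjoint (K m) (u k m - v m)).
    rewrite (run_x K F h G omega gamma eta xR u p x a run) !adjointB.
    by rewrite opprB addrA subrK addrAC.
  apply: (coer _ _ _ _ _ _ dE) => m.
    exact: grad_cocoercive (LF_gt0 m) (F_smooth m) (F_convex m) _ _.
  exact: F_strong_mono F_smooth F_strong F_convex m _ _.
have K_bound := joint_opnorm_bound K omega eta S_le.
have lyap_ge0 := lyapunov_ge0 K omega gamma eta M_gt0 omega_gt0 gamma_gt0 eta_gt0
  K_bound.
have gradF0 m z : grad (F m) z = 0.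
  apply/esym/(subdiff_grad _ _ (F_smooth m)) => y.
  by rewrite /= inner0l !F0 adde0.
have g0 k : \sum_m (grad (F m) (x k.+1 m) - grad (F m) xs) = 0.
  by rewrite big1// => m _; rewrite !gradF0 subrr.
have [muG0|muF0] := mu_pos.
  apply: (rate (2 * gamma * muG)) => // [|k]; first by rewrite !mulr_gt0.
  by rewrite g0 scaler0 inner0l mulr0 addr0 lerDr.
(* Left is the case of null functions that are strongly convex. *)
have X0 := zero_strong_trivial F LF muF F_smooth F_strong F_convex _
  (muF0 (Ordinal M_gt0)) (F0 _).
apply: (rate 1) => // k.
by rewrite g0 scaler0 inner0l mulr0 addr0 (X0 (xR k.+1 - xs)) normr0 expr0n /=
  !mulr0 addr0.
Qed.
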